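(* For every constant $0<c<2$, there is a decision tree reduction of $\mathrm{polylog}(N)$ query complexity from $c$-$\textsc{Dual-AMGM-LC}$ to $\textsc{Lossy-Code}$.
   Context: Query model: inputs are functions between finite sets accessed by querying bits of the encodings of their values; a decision tree reduction computes each input bit of the target instance by a decision tree over the source input and maps each target solution back to a source solution by a decision tree; its complexity is log of the target input length plus maximum depth. $\textsc{Lossy-Code}$: given $f:[M]\to[2M]$, $g:[2M]\to[M]$, find $x\in[2M]$ with $f(g(x))\ne x$. $c$-$\textsc{Dual-AMGM-LC}$: let $V=[2N]$ and $H=[cN^2]$. The input is a coloring $C:V\to\{0,1\}$ and maps $F:H\to V\times V$, $G:V\times V\to H$. Let $P=\{(u,v)\in V\times V: C(u)=C(v)\}$. A solution is a pigeon $x\in P$ with $F(G(x))\neq x$. *)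

(* Defs.v *)
From mathcomp Require Import all_boot all_order all_algebra.
From mathcomp Require Import reals.

Set Implicit Arguments.
Unset Strict Implicit.
Unset Printing Implicit Defensive.

Inductive dtree (Q A : Type) : Type :=
| Leaf of A
| Query of Q & dtree Q A & dtree Q A.

(* The first subtree of a query is followed on answer [false], the second one
   on answer [true]. *)
Fixpoint dt_eval (Q A : Type) (t : dtree Q A) (oracle : Q -> bool) : A :=
  match t with
  | Leaf a => a
  | Query q t0 t1 => dt_eval (if oracle q then t1 else t0) oracle
  end.

Fixpoint dt_depth (Q A : Type) (t : dtree Q A) : nat :=
  match t with
  | Leaf _ => 0
  | Query _ t0 t1 => (maxn (dt_depth t0) (dt_depth t1)).+1
  end.

(* Only [bits x : position -> bool] is accessible to decision trees, for an
   input [x]; the length of an input is [#|position|]. *)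
Record search_problem : Type := SearchProblem {
  input : Type;
  position : finType;
  bits : input -> position -> bool;
  candidate : finType;
  is_solution : input -> candidate -> bool
}.

(* By [red_bits], the bits computed by the trees [in_tree] on a source input
   always form the encoding of a legal target input. *)
Record dt_reduction (S T : search_problem) : Type := DTReduction {
  in_tree : position T -> dtree (position S) bool;
  sol_tree : candidate T -> dtree (position S) (candidate S);
  red_input : input S -> input T;
  red_bits : forall (x : input S) (p : position T),
    dt_eval (in_tree p) (bits x) = bits (red_input x) p;
  red_sol : forall (x : input S) (y : candidate T),
    is_solution (red_input x) y ->
    is_solution x (dt_eval (sol_tree y) (bits x))
}.

Definition red_complexity (S T : search_problem) (r : dt_reduction S T) : nat :=
  up_log 2 #|position T| +
  maxn (\max_(p : position T) dt_depth (in_tree r p))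
       (\max_(y : candidate T) dt_depth (sol_tree r y)).

(* Problem families are indexed by positive integers.  Positivity of [M] matters:
   for [M = 0] the Lossy-Code problem below has an input but no solution. *)
Definition dt_reducible (t : nat -> nat) (S T : nat -> search_problem) : Prop :=
  forall N : nat, 0 < N ->
    exists M : nat, 0 < M /\
      exists r : dt_reduction (S N) (T M), red_complexity r <= t N.

Definition polylog (t : nat -> nat) : Prop :=
  exists A k : nat, forall N : nat, 1 < N -> t N <= A * up_log 2 N ^ k.

(* Elements of ['I_m] are written in binary on [ceil (log2 m)] bits, least
   significant bit first. *)
Definition code_len (m : nat) : nat := up_log 2 m.

Definition code_bit (m : nat) (x : 'I_m) (j : 'I_(code_len m)) : bool :=
  odd (x %/ 2 ^ j).

Record lossy_code_input (M : nat) : Type := LossyCodeInput {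
  lc_f : 'I_M -> 'I_(2 * M);
  lc_g : 'I_(2 * M) -> 'I_M
}.

Definition lossy_code_position (M : nat) : finType :=
  (('I_M * 'I_(code_len (2 * M))) + ('I_(2 * M) * 'I_(code_len M)))%type.

Definition lossy_code_bits (M : nat) (I : lossy_code_input M)
    (p : lossy_code_position M) : bool :=
  match p with
  | inl (x, j) => code_bit (lc_f I x) j
  | inr (y, j) => code_bit (lc_g I y) j
  end.

Definition lossy_code (M : nat) : search_problem :=
  {| input := lossy_code_input M;
     position := lossy_code_position M;
     bits := @lossy_code_bits M;
     candidate := 'I_(2 * M);
     is_solution := fun I x => lc_f I (lc_g I x) != x |}.

Record dual_amgm_input (N K : nat) : Type := DualAMGMInput {
  da_C : 'I_(2 * N) -> bool;
  da_F : 'I_K -> 'I_(2 * N) * 'I_(2 * N);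
  da_G : 'I_(2 * N) * 'I_(2 * N) -> 'I_K
}.

(* In the second summand, the boolean selects the component of the pair
   [da_F I h]: [false] for the first one, [true] for the second one. *)
Definition dual_amgm_position (N K : nat) : finType :=
  ('I_(2 * N)
   + ('I_K * (bool * 'I_(code_len (2 * N))))
   + (('I_(2 * N) * 'I_(2 * N)) * 'I_(code_len K)))%type.

Definition dual_amgm_bits (N K : nat) (I : dual_amgm_input N K)
    (p : dual_amgm_position N K) : bool :=
  match p with
  | inl (inl v) => da_C I v
  | inl (inr (h, (b, j))) =>
      code_bit (if b then (da_F I h).2 else (da_F I h).1) j
  | inr (uv, j) => code_bit (da_G I uv) j
  end.

Definition dual_amgm_pigeon (N K : nat) (I : dual_amgm_input N K)
    (x : 'I_(2 * N) * 'I_(2 * N)) : bool :=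
  da_C I x.1 == da_C I x.2.

Definition dual_amgm_holes (N K : nat) : search_problem :=
  {| input := dual_amgm_input N K;
     position := dual_amgm_position N K;
     bits := @dual_amgm_bits N K;
     candidate := ('I_(2 * N) * 'I_(2 * N))%type;
     is_solution := fun I x =>
       dual_amgm_pigeon I x && (da_F I (da_G I x) != x) |}.

(* The number of holes c N^2 is rounded down. *)
Definition dual_amgm_lc (R : realType) (c : R) (N : nat) : search_problem :=
  dual_amgm_holes N (Num.truncn (c * N%:R ^+ 2)%R).

(* Main.v *)
(** Read a word of 2m+1 vertices.  Sorting its positions by color arranges them
    into m monochromatic pairs and one left-over vertex, and the m pairs can be
    sent through G.  To undo this one needs the color pattern A of the word.
    The colors of the m pairs, which F restores together with the pairs, are
    free information: ordering the pairs suitably, they can encode any subset B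
    of the m slots with |B| = floor(|A| / 2), so that A is determined by B and
    a label below E = (2m+2)(2m+1) 2^m, since
      C(2m+2, 2i+1) <= E * C(m, i).
    There are thus at most E (c N^2)^m (2N) codes for (2N)^(2m+1) words, and as
    c < 2 the ratio is below 1/2 for a suitable m depending only on c.  A word
    that is not recovered from its code contains a pair violating F (G x) = x. *)

Require Import Defs.
From mathcomp Require Import all_boot all_order all_algebra.
From mathcomp Require Import reals.
From mathcomp Require Import zify ring lra.

Set Implicit Arguments.
Unset Strict Implicit.
Unset Printing Implicit Defensive.

(** * Binomial estimates for counting color patterns *)

(* Both sides are [(2m+2)! / (i! l!)^2] with [m = i + l]. *)
Lemma bin_double_odd (i l : nat) :
  'C((i + l).*2.+2, i.*2.+1) * ((i.*2.+1 * 'C(i.*2, i)) * (l.*2.+1 * 'C(l.*2, l)))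
  = (i + l).*2.+2 * (i + l).*2.+1 * ('C((i + l).*2, i + l) * 'C(i + l, i) ^ 2).
Proof.
have C2 k : 'C(k.*2, k) * (k`! * k`!) = (k.*2)`!.
  by rewrite -[in X in _ = X](@bin_fact k.*2 k) -addnn ?leq_addr// addnK.
have h1 := @bin_fact (i + l).*2.+2 i.*2.+1.
have h2 := @bin_fact (i + l) i (leq_addr _ _).
have e1 : (i + l).*2.+2 - i.*2.+1 = l.*2.+1 by lia.
rewrite e1 in h1; rewrite addKn in h2.
have {}h1 := h1 ltac:(lia).
have ci := C2 i; have cl := C2 l; have cm := C2 (i + l).
rewrite !factS in h1.
have fp k : 0 < k`! by exact: fact_gt0.
apply/eqP; rewrite -(@eqn_pmul2r (i`! ^ 2 * l`! ^ 2)) ?muln_gt0 ?expn_gt0 ?fp//.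
apply/eqP.
transitivity ('C((i + l).*2.+2, i.*2.+1) * (i.*2.+1 * (i.*2)`! * (l.*2.+1 * (l.*2)`!))).
  by rewrite -ci -cl; ring.
by rewrite h1 -cm -h2; ring.
Qed.

Lemma central_bin_ge (i : nat) : 4 ^ i <= i.*2.+1 * 'C(i.*2, i).
Proof.
(* For positive index the factor 2k already suffices, and with it the induction step is the exact
   identity 2(n+1) C(2n+2, n+1) = 4 (2n+1) C(2n, n). *)
suff H k : 4 ^ k.+1 <= k.+1.*2 * 'C(k.+1.*2, k.+1).
  by case: i => [|i]; [rewrite bin0|apply: leq_trans (H i) _; rewrite leq_mul2r leqnSn orbT].
elim: k => [|k IH]; first by [].
have e : k.+2.*2 * 'C(k.+2.*2, k.+2) = 4 * (k.+1.*2.+1 * 'C(k.+1.*2, k.+1)).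
  have h1 : k.+2.*2 * 'C(k.+1.*2.+1, k.+1) = k.+2 * 'C(k.+2.*2, k.+2).
    exact: mul_bin_diag k.+2.*2 k.+1.
  have h2 : k.+1.*2.+1 * 'C(k.+1.*2, k.+1) = k.+2 * 'C(k.+1.*2.+1, k.+1).
    have -> : k.+2 = k.+1.*2.+1 - k.+1 by lia.
    exact: mul_bin_down k.+1.*2.+1 k.+1.
  by rewrite h2; lia.
rewrite e expnS leq_mul2l /=; apply: leq_trans IH _.
by rewrite leq_mul2r leqnSn orbT.
Qed.

Lemma bin_leq_exp2 (n k : nat) : 'C(n, k) <= 2 ^ n.
Proof.
elim: n k => [|n IH] [|k]; rewrite ?bin0 ?bin0n ?expn_gt0//.
by rewrite binS expnS mul2n -addnn leq_add.
Qed.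

(** In [bin_double_odd] the two central factors on the left are at least 4^i and 4^l, whose product
    4^m cancels C(2m, m) <= 4^m. One of the two factors C(m, i) is bounded by 2^m, the other one
    remains. *)
Lemma bin_double_odd_leq (m i : nat) :
  'C(m.*2.+2, i.*2.+1) <= m.*2.+2 * m.*2.+1 * 2 ^ m * 'C(m, i).
Proof.
have [le_im|lt_mi] := leqP i m; last by rewrite bin_small//; lia.
rewrite -(subnKC le_im); set l := m - i; move: l => l.
rewrite -(@leq_pmul2r (4 ^ i * 4 ^ l)) ?muln_gt0 ?expn_gt0//.
apply: leq_trans (leq_mul (leqnn _) (leq_mul (central_bin_ge i) (central_bin_ge l))) _.
rewrite bin_double_odd -!mulnA leq_mul2l leq_mul2l /= -expnD.
rewrite mulnC -mulnn -mulnA leq_mul ?bin_leq_exp2// leq_mul2l.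
by apply/orP; right; apply: leq_trans (bin_leq_exp2 _ _) _; rewrite -mul2n expnM.
Qed.

(** * Functions computed by shallow decision trees *)

(** Lives in [Type], so that the trees of a whole family can be extracted as a function and stored
    in a reduction. *)
Definition dt_computes (S : search_problem) (A : Type) (d : nat)
    (phi : input S -> A) : Type :=
  {t : dtree (position S) A |
    dt_depth t <= d & forall x, dt_eval t (bits x) = phi x}.

Lemma dt_computes_query (S : search_problem) (p : position S) :
  dt_computes 1 (fun x : input S => bits x p).
Proof. by exists (Query p (Leaf _ false) (Leaf _ true)) => //= x; case: (bits x p). Qed.

Lemma dt_computes_const (S : search_problem) (A : Type) (a : A) :
  dt_computes 0 (fun _ : input S => a).
Proof. by exists (Leaf _ a). Qed.

Lemma dt_computes_weaken (S : search_problem) (A : Type) (d1 d2 : nat)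
    (phi : input S -> A) :
  d1 <= d2 -> dt_computes d1 phi -> dt_computes d2 phi.
Proof. by move=> le_d [t td tE]; exists t => //; exact: leq_trans le_d. Qed.

Lemma dt_computes_ext (S : search_problem) (A : Type) (d : nat)
    (phi psi : input S -> A) :
  phi =1 psi -> dt_computes d phi -> dt_computes d psi.
Proof. by move=> e [t td tE]; exists t => // x; rewrite tE e. Qed.

(** Adaptive queries: each leaf [a] of the first tree is replaced by the tree for [psi a], so depths
    add. *)
Lemma dt_computes_bind (S : search_problem) (A B : Type) (d1 d2 : nat)
    (phi : input S -> A) (psi : A -> input S -> B) :
  dt_computes d1 phi -> (forall a, dt_computes d2 (psi a)) ->
  dt_computes (d1 + d2) (fun x => psi (phi x) x).
Proof.
move=> [t td tE] u; pose ut a := s2val (u a).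
have utd a : dt_depth (ut a) <= d2 by rewrite /ut; case: (u a).
have utE a x : dt_eval (ut a) (bits x) = psi a x by rewrite /ut; case: (u a).
pose fix graft t := match t with
  | Leaf a => ut a | Query q t0 t1 => Query q (graft t0) (graft t1) end.
have graftE s o : dt_eval (graft s) o = dt_eval (ut (dt_eval s o)) o.
  by elim: s => //= q s0 IH0 s1 IH1; case: (o q).
have graft_d s : dt_depth (graft s) <= dt_depth s + d2.
  elim: s => [a|q s0 IH0 s1 IH1] //=.
  by rewrite addSn ltnS addn_maxl geq_max !leq_max IH0 IH1 orbT.
exists (graft t) => [|x]; last by rewrite graftE utE tE.
by apply: leq_trans (graft_d _) _; rewrite leq_add2r.
Qed.

Lemma dt_computes_map (S : search_problem) (A B : Type) (d : nat)
    (phi : input S -> A) (h : A -> B) :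
  dt_computes d phi -> dt_computes d (fun x => h (phi x)).
Proof.
move=> c; rewrite -[d]addn0; apply: (dt_computes_bind (psi := fun a _ => h a)) => // a.
exact: dt_computes_const.
Qed.

Lemma dt_computes_ffun (S : search_problem) (A : Type) (d m : nat)
    (phi : 'I_m -> input S -> A) :
  (forall i, dt_computes d (phi i)) ->
  dt_computes (m * d) (fun x => [ffun i => phi i x]).
Proof.
elim: m phi => [|m IH] phi c.
  apply: dt_computes_ext (dt_computes_const _ [ffun i : 'I_0 => False_rect A (ltac:(by case: i))]).
  by move=> x; apply/ffunP => -[].
rewrite mulSn.
pose psi a (x : input S) :=
  [ffun i => oapp (fun j => phi (lift ord0 j) x) a (unlift ord0 i)].
apply: (dt_computes_ext (phi := fun x => psi (phi ord0 x) x)) => [x|].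
  by apply/ffunP => i; rewrite !ffunE; case: unliftP => [j|] ->.
apply: dt_computes_bind => // a.
pose cons (f : {ffun 'I_m -> A}) := [ffun i => oapp f a (unlift ord0 i)].
apply: (dt_computes_ext (phi := fun x => cons [ffun j => phi (lift ord0 j) x])) => [x|].
  by apply/ffunP => i; rewrite !ffunE; case: unliftP => [j|] //= _; rewrite ffunE.
apply: dt_computes_map; exact: IH.
Qed.

Lemma odd_expn_divn_inj (L x y : nat) : x < 2 ^ L -> y < 2 ^ L ->
  (forall j, j < L -> odd (x %/ 2 ^ j) = odd (y %/ 2 ^ j)) -> x = y.
Proof.
elim: L x y => [|L IH] x y ltx lty e; first by move: x y ltx lty {e} => [|?] [|?].
have e0 := e 0 isT; rewrite !divn1 in e0.
rewrite -[x]odd_double_half -[y]odd_double_half e0; congr (_ + _.*2).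
rewrite -!divn2; apply: IH => [||j ltj].
- by rewrite ltn_divLR// -expnSr.
- by rewrite ltn_divLR// -expnSr.
- by rewrite -!divnMA -expnS e.
Qed.

Lemma code_bit_inj (m : nat) (x y : 'I_m) :
  (forall j, code_bit x j = code_bit y j) -> x = y.
Proof.
move=> e; apply/val_inj/(@odd_expn_divn_inj (code_len m)) => [||j ltj].
- exact: leq_trans (ltn_ord x) (up_logP _ _).
- exact: leq_trans (ltn_ord y) (up_logP _ _).
- exact: (e (Ordinal ltj)).
Qed.

Lemma dt_computes_ord (S : search_problem) (k : nat) (v : input S -> 'I_k) :
  0 < k -> (forall j, dt_computes 1 (fun x => code_bit (v x) j)) ->
  dt_computes (code_len k) v.
Proof.
move=> k_gt0 c.
(* The default is the value for bit strings that encode no element; these never arise from an input,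
   but their leaves need a label. *)
pose dec (b : {ffun 'I_(code_len k) -> bool}) :=
  odflt (Ordinal k_gt0) [pick u : 'I_k | [forall j, code_bit u j == b j]].
apply: (dt_computes_ext (phi := fun x => dec [ffun j => code_bit (v x) j])).
  move=> x; rewrite /dec; case: pickP => [u /forallP e|/(_ (v x))/forallP[] j].
    by apply: code_bit_inj => j; rewrite (eqP (e j)) ffunE.
  by rewrite ffunE.
apply/dt_computes_map/(@dt_computes_weaken _ _ (code_len k * 1)); first by rewrite muln1.
exact: dt_computes_ffun.
Qed.

(** * Reductions to Lossy-Code from compression schemes *)

(** The encoder plays g and the decoder plays f, after numbering [Y] and [W]; a solution is then a
    word that its code does not recover. *)
Lemma dt_reduction_lossy_code (S : search_problem) (M d : nat) (Y W : finType)
    (enc : input S -> Y -> W) (dec : input S -> W -> Y)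
    (sol : input S -> Y -> candidate S) :
  0 < M -> #|Y| = 2 * M -> #|W| <= M ->
  (forall y, dt_computes d (enc^~ y)) ->
  (forall w, dt_computes d (dec^~ w)) ->
  (forall y, dt_computes d (sol^~ y)) ->
  (forall x y, dec x (enc x y) != y -> is_solution x (sol x y)) ->
  exists r : dt_reduction S (lossy_code M),
    red_complexity r <= up_log 2 #|lossy_code_position M| + d.
Proof.
move=> M_gt0 cY leW cenc cdec csol solP.
pose y0 : Y := enum_val (cast_ord (esym cY) (Ordinal (ltac:(lia) : 0 < 2 * M))).
pose toY (i : 'I_(2 * M)) : Y := enum_val (cast_ord (esym cY) i).
pose ofY (y : Y) : 'I_(2 * M) := cast_ord cY (enum_rank y).
have toYK : cancel toY ofY by move=> i; rewrite /ofY /toY enum_valK cast_ordKV.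
have ofYK : cancel ofY toY by move=> y; rewrite /ofY /toY cast_ordK enum_rankK.
pose ofW (w : W) : 'I_M := widen_ord leW (enum_rank w).
pose f x (i : 'I_M) := oapp (dec x) y0 [pick w | ofW w == i].
have fW x w : f x (ofW w) = dec x w.
  rewrite /f; case: pickP => [w' /eqP/(congr1 val)/= /ord_inj/enum_rank_inj ->//|].
  by move/(_ w); rewrite eqxx.
have cf i : dt_computes d (f^~ i).
  by rewrite /f; case: pickP => [w _|_] //=; apply: dt_computes_weaken (dt_computes_const _ _).
pose ri x := LossyCodeInput (fun i => ofY (f x i)) (fun j => ofW (enc x (toY j))).
have cin p : dt_computes d (fun x => lossy_code_bits (ri x) p).
  case: p => [[i j]|[i j]] /=.
    exact: (dt_computes_map (fun y => code_bit (ofY y) j)).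
  exact: (dt_computes_map (fun w => code_bit (ofW w) j)).
pose it p := s2val (cin p); pose st i := s2val (csol (toY i)).
have itE x p : dt_eval (it p) (bits x) = lossy_code_bits (ri x) p.
  exact: (s2valP' (cin p)).
have stP x (i : 'I_(2 * M)) : is_solution (s := lossy_code M) (ri x) i ->
    is_solution x (dt_eval (st i) (bits x)).
  rewrite /= fW (s2valP' (csol (toY i)) x) => ne; apply: solP.
  by apply: contraNneq ne => ->; rewrite toYK.
exists (@DTReduction S (lossy_code M) it st ri itE stP).
rewrite leq_add2l geq_max; apply/andP; split; apply/bigmax_leqP => p _ /=.
  exact: (s2valP (cin p)).
exact: (s2valP (csol (toY p))).
Qed.

(* Without holes there is no [G], but the trees must still be given. *)
Lemma dt_reduction_empty (S : search_problem) (M : nat) (s0 : candidate S) :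
  (input S -> False) ->
  exists r : dt_reduction S (lossy_code M),
    red_complexity r <= up_log 2 #|lossy_code_position M|.
Proof.
move=> noS; exists (@DTReduction S (lossy_code M) (fun _ => Leaf _ false)
  (fun _ => Leaf _ s0) (fun x => False_rect _ (noS x)) (fun x => False_ind _ (noS x))
  (fun x => False_ind _ (noS x))).
by rewrite /red_complexity /= !big1// addn0.
Qed.

(** * Bijections that carry one predicate to another *)

Definition split_enum (X : finType) (a : pred X) : seq X := enum a ++ enum (predC a).

Lemma mem_split_enum (X : finType) (a : pred X) (x : X) : x \in split_enum a.
Proof. by rewrite mem_cat !mem_enum !inE orbN. Qed.

Lemma split_enum_uniq (X : finType) (a : pred X) : uniq (split_enum a).
Proof.
rewrite cat_uniq !enum_uniq andbT /=; apply/hasPn => x.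
by rewrite !mem_enum.
Qed.

Lemma size_split_enum (X : finType) (a : pred X) : size (split_enum a) = #|X|.
Proof. by rewrite size_cat -!cardE cardC. Qed.

Lemma split_enum_nth (X : finType) (a : pred X) (x0 : X) (k : nat) :
  k < #|X| -> a (nth x0 (split_enum a) k) = (k < #|a|).
Proof.
move=> ltk; rewrite nth_cat -cardE; case: ltnP => le.
  by have := mem_nth x0 (s := enum a) (n := k); rewrite -cardE mem_enum => /(_ le).
have := mem_nth x0 (s := enum (predC a)) (n := k - #|a|).
rewrite -cardE mem_enum inE /= => H; apply/negbTE/H.
by rewrite ltn_subLR// cardC.
Qed.

(** Elements are matched by rank in lists that put the predicate first. Between types of equal size,
    swapping the roles inverts the map, and equal counts make it carry [a] to [b]. *)
Definition transport (X Y : finType) (a : pred X) (b : pred Y) (y0 : Y) (x : X) : Y :=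
  nth y0 (split_enum b) (index x (split_enum a)).

Lemma transportK (X Y : finType) (a : pred X) (b : pred Y) (x0 : X) (y0 : Y) :
  #|X| = #|Y| -> cancel (transport a b y0) (transport b a x0).
Proof.
move=> cXY x; rewrite /transport index_uniq ?split_enum_uniq//.
  by rewrite nth_index ?mem_split_enum.
by rewrite size_split_enum -cXY -(size_split_enum a) index_mem mem_split_enum.
Qed.

Lemma transport_pred (X Y : finType) (a : pred X) (b : pred Y) (y0 : Y) (x : X) :
  #|X| = #|Y| -> #|a| = #|b| -> b (transport a b y0 x) = a x.
Proof.
move=> cXY cab; have ltx : index x (split_enum a) < #|X|.
  by rewrite -(size_split_enum a) index_mem mem_split_enum.
rewrite split_enum_nth -?cXY// -cab -(@split_enum_nth _ a x)//.
by rewrite nth_index ?mem_split_enum.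
Qed.

(** * Coding a color pattern by a smaller set and a label *)

(* Division of the rank of [s] in its fiber by the size of the [q]-fiber: the
   remainder chooses the point of [T], the quotient is the label. *)
Lemma label_with_fibers (S T I : finType) (E : nat) (p : S -> I) (q : T -> I) :
  (forall i, #|[set s | p s == i]| <= E * #|[set t | q t == i]|) ->
  exists h : S -> T * 'I_E, injective h /\ forall s, q (h s).1 = p s.
Proof.
move=> le.
pose fp s := [set s' | p s' == p s]; pose fq s := [set t | q t == p s].
pose r s := index s (enum (fp s)).
have ltr s : r s < #|fp s| by rewrite cardE index_mem mem_enum inE.
have fq_gt0 s : 0 < #|fq s|.
  by have := leq_trans (ltr s) (le (p s)); rewrite -/(fq s); case: #|fq s|; rewrite ?muln0.
have ltm s : r s %% #|fq s| < #|fq s| by rewrite ltn_mod.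
have ltd s : r s %/ #|fq s| < E.
  by rewrite ltn_divLR//; apply: leq_trans (le (p s)).
pose h s := (enum_val (Ordinal (ltm s)), Ordinal (ltd s)).
have hq s : q (h s).1 = p s.
  by have := enum_valP (Ordinal (ltm s)); rewrite inE => /eqP.
exists h; split=> // s1 s2 e.
have ep : p s1 = p s2 by rewrite -!hq e.
have efp : fp s1 = fp s2 by rewrite /fp ep.
have efq : fq s1 = fq s2 by rewrite /fq ep.
have ed : r s1 %/ #|fq s1| = r s2 %/ #|fq s2| by move: e => [_ ->].
have em : r s1 %% #|fq s1| = r s2 %% #|fq s2|.
  (* The two remainders have types indexed by different fiber terms; the fibers must be identified
     before [enum_val] can be cancelled. *)
  have ev (A B : {set T}) (i : 'I_#|A|) (j : 'I_#|B|) :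
      A = B -> enum_val i = enum_val j -> i = j :> nat.
    by move=> eAB; case: B / eAB j => j /enum_val_inj ->.
  by apply: (ev _ _ (Ordinal (ltm s1)) (Ordinal (ltm s2)) efq); move: e => [].
have er : r s1 = r s2 by rewrite (divn_eq (r s1) #|fq s1|) ed em efq -divn_eq.
have m1 : s1 \in enum (fp s1) by rewrite mem_enum inE.
have m2 : s2 \in enum (fp s1) by rewrite mem_enum inE ep.
by rewrite -(nth_index s1 m1) -(nth_index s1 m2); move: er; rewrite /r -efp => ->.
Qed.

Definition pattern_cost (m : nat) : nat := m.*2.+2 * m.*2.+1 * 2 ^ m.

(** Sizes 2i and 2i+1 both halve to i, and Pascal's rule merges the two counts; this is why 2m+2
    appears for words of length 2m+1. *)
Lemma half_card_fiber (m i : nat) :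
  #|[set A : {set 'I_(m.*2.+1)} | #|A|./2 == i]| = 'C(m.*2.+2, i.*2.+1).
Proof.
have -> : [set A : {set 'I_(m.*2.+1)} | #|A|./2 == i] =
    [set A : {set 'I_(m.*2.+1)} | #|A| == i.*2.+1] :|:
    [set A : {set 'I_(m.*2.+1)} | #|A| == i.*2].
  by apply/setP => A; rewrite !inE; move: #|A| => k; lia.
rewrite cardsU !card_draws card_ord binS.
have -> : [set A : {set 'I_(m.*2.+1)} | #|A| == i.*2.+1] :&:
    [set A : {set 'I_(m.*2.+1)} | #|A| == i.*2] = set0.
  by apply/setP => A; rewrite !inE; move: #|A| => k; lia.
by rewrite cards0 subn0.
Qed.

Lemma pattern_label (m : nat) :
  exists h : {set 'I_(m.*2.+1)} -> {set 'I_m} * 'I_(pattern_cost m),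
    injective h /\ forall A, #|(h A).1| = #|A|./2.
Proof.
have lt1 (A : {set 'I_(m.*2.+1)}) : #|A|./2 < m.+1.
  by have := subset_leq_card (subsetT A); rewrite cardsT card_ord; lia.
have lt2 (B : {set 'I_m}) : #|B| < m.+1.
  by have := subset_leq_card (subsetT B); rewrite cardsT card_ord.
have [|h [hinj hE]] := @label_with_fibers _ _ _ (pattern_cost m)
    (fun A => Ordinal (lt1 A)) (fun B => Ordinal (lt2 B)).
  move=> i.
  under eq_finset do rewrite -val_eqE /=.
  rewrite half_card_fiber.
  under [X in _ <= _ * #|pred_of_set X|]eq_finset do rewrite -val_eqE /=.
  by rewrite card_draws card_ord bin_double_odd_leq.
by exists h; split=> // A; have /(congr1 val) := hE A.
Qed.

(** * Sorting a word into monochromatic pairs *)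

(* [Some (i, b)] is component [b] of the [i]-th pair and [None] the left-over
   position. *)
Definition slot (m : nat) : finType := option ('I_m * bool).

Definition slot_color (m : nat) (B : {set 'I_m}) (b : bool) (x : slot m) : bool :=
  oapp (fun z => z.1 \in B) b x.

Lemma card_slot (m : nat) : #|slot m| = m.*2.+1.
Proof. by rewrite card_option card_prod card_ord card_bool muln2. Qed.

(** For |B| = floor(|A| / 2) and b the parity of |A| the count is |A|, so slots and positions can be
    matched by color. *)
Lemma card_slot_color (m : nat) (B : {set 'I_m}) (b : bool) :
  #|slot_color B b| = #|B|.*2 + b.
Proof.
pose D : {set slot m} := Some @: setX B [set: bool].
have cD : #|D| = #|B|.*2.
  by rewrite card_imset ?cardsX ?cardsT ?card_bool ?muln2// => ? ? [].
have inD z : (Some z \in D) = (z.1 \in B).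
  rewrite mem_imset; last by move=> ? ? [].
  by case: z => i c; rewrite in_setX in_setT andbT.
have nD : None \notin D by apply/imsetP => -[].
rewrite -cD; transitivity #|[set x | slot_color B b x]|; first by rewrite cardsE.
case: b.
  have := cardsU1 None D; rewrite nD addnC => <-.
  by apply: eq_card => -[z|]; rewrite !inE /= ?inD.
rewrite addn0; apply: eq_card => -[z|]; rewrite !inE /= ?inD//.
exact/esym/negbTE.
Qed.
Section SortedPairs.

Variables (m E : nat) (h : {set 'I_(m.*2.+1)} -> {set 'I_m} * 'I_E).
Hypothesis h_inj : injective h.
Hypothesis card_h : forall A, #|(h A).1| = #|A|./2.

Implicit Types (A : {set 'I_(m.*2.+1)}) (V : Type).

(** The arrangement depends on A alone, so a decoder that knows A can undo it. *)
Definition place A : slot m -> 'I_(m.*2.+1) :=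
  transport (slot_color (h A).1 (odd #|A|)) (mem A) ord0.

Definition unplace A : 'I_(m.*2.+1) -> slot m :=
  transport (mem A) (slot_color (h A).1 (odd #|A|)) None.

Lemma unplaceK A : cancel (unplace A) (place A).
Proof. by apply: transportK; rewrite card_slot card_ord. Qed.

(** With A the positions of color [true], both components of pair i get the color i \in [(h A).1]:
    every pair is a pigeon, and the colors spell the set B. *)
Lemma place_in A x : (place A x \in A) = slot_color (h A).1 (odd #|A|) x.
Proof.
apply: (transport_pred (b := mem A)); first by rewrite card_slot card_ord.
by rewrite card_slot_color card_h addnC odd_double_half.
Qed.

Definition paired V A (y : {ffun 'I_(m.*2.+1) -> V}) : {ffun 'I_m -> V * V} :=
  [ffun i => (y (place A (Some (i, false))), y (place A (Some (i, true))))].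

Definition unpaired V A (q : {ffun 'I_m -> V * V}) (v : V) :
    {ffun 'I_(m.*2.+1) -> V} :=
  [ffun p => if unplace A p is Some (i, b) then if b then (q i).2 else (q i).1
             else v].

Lemma pairedK V A (y : {ffun 'I_(m.*2.+1) -> V}) :
  unpaired A (paired A y) (y (place A None)) = y.
Proof.
apply/ffunP => p; rewrite ffunE -[in RHS](unplaceK A p).
by case: (unplace A p) => [[i []]|]; rewrite ?ffunE.
Qed.

Definition pattern_of (B : {set 'I_m}) (e : 'I_E) : {set 'I_(m.*2.+1)} :=
  odflt set0 [pick A | h A == (B, e)].

Lemma pattern_ofK A : pattern_of (h A).1 (h A).2 = A.
Proof.
rewrite /pattern_of; case: pickP => [A'|/(_ A)]; rewrite -surjective_pairing.
  by move/eqP/h_inj.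
by rewrite eqxx.
Qed.

End SortedPairs.

(** * The compression scheme and its query cost *)

Section Reduction.

Variables (N K m E : nat) (h : {set 'I_(m.*2.+1)} -> {set 'I_m} * 'I_E).
Hypotheses (N_gt0 : 0 < N) (K_gt0 : 0 < K).
Hypothesis h_inj : injective h.
Hypothesis card_h : forall A, #|(h A).1| = #|A|./2.

Local Notation S := (dual_amgm_holes N K).
Local Notation vertex := 'I_(2 * N).
Local Notation word := {ffun 'I_(m.*2.+1) -> vertex}.
Local Notation code := ('I_E * {ffun 'I_m -> 'I_K} * vertex)%type.
Implicit Types (I : input S) (y : word) (w : code).

Definition colors I y : {ffun 'I_(m.*2.+1) -> bool} := [ffun p => da_C I (y p)].

(** Only the label is stored, not the set [(h A).1], which the colors of the pairs give back. *)
Definition compress I y : code :=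
  let A := [set p | colors I y p] in
  ((h A).2, [ffun i => da_G I (paired h A y i)], y (place h A None)).

Definition fetched I (hs : {ffun 'I_m -> 'I_K}) : {ffun 'I_m -> vertex * vertex} :=
  [ffun i => da_F I (hs i)].

(** The colors of the first components yield B. They are wrapped in a finite function to match
    [dt_computes_ffun]; likewise in [bad_pair]. *)
Definition decompress I w : word :=
  let q := fetched I w.1.2 in
  unpaired h (pattern_of h [set i | [ffun i => da_C I (q i).1] i] w.1.1) q w.2.

Definition bad_pair I y : vertex * vertex :=
  let q := paired h [set p | colors I y p] y in
  oapp q (y ord0, y ord0) [pick i | [ffun i => da_F I (da_G I (q i))] i != q i].

(** If F restores every pair, the colors give B, B and the label give A, and A with the pairs and
    the left-over vertex gives the word. So a failure exposes a pair that F does not restore, and it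
    is monochromatic. *)
Lemma decompressP I y :
  decompress I (compress I y) != y -> is_solution I (bad_pair I y).
Proof.
set A := [set p | colors I y p]; set q := paired h A y.
have qC i : (da_C I (q i).1 = (i \in (h A).1)) * (da_C I (q i).2 = (i \in (h A).1)).
  have inA p : da_C I (y p) = (p \in A) by rewrite inE ffunE.
  by rewrite ffunE /= !inA !place_in.
rewrite /bad_pair -/A -/q; case: pickP => [i|q_ok].
  by rewrite ffunE /= /dual_amgm_pigeon !qC eqxx.
suff -> : decompress I (compress I y) = y by rewrite eqxx.
have fetchedE : fetched I (compress I y).1.2 = q.
  by apply/ffunP => i; rewrite ffunE /= ffunE -/A -/q; have := q_ok i; rewrite ffunE => /negbFE/eqP.
rewrite /decompress fetchedE.
have -> : [set i | [ffun i => da_C I (q i).1] i] = (h A).1.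
  by apply/setP => i; rewrite inE ffunE qC.
by rewrite /= pattern_ofK// pairedK.
Qed.

Lemma dt_computes_color (v : vertex) : dt_computes 1 (fun I => da_C I v).
Proof. exact: (@dt_computes_query S (inl (inl v))). Qed.

Lemma dt_computes_fetch (k : 'I_K) :
  dt_computes (2 * code_len (2 * N)) (fun I => da_F I k).
Proof.
have c b : dt_computes (code_len (2 * N))
    (fun I => if b then (da_F I k).2 else (da_F I k).1).
  apply: dt_computes_ord => [|j]; first by rewrite muln_gt0.
  exact: (@dt_computes_query S (inl (inr (k, (b, j))))).
apply: (@dt_computes_weaken _ _ (code_len (2 * N) + code_len (2 * N))).
  by rewrite addnn -mul2n.
apply: (@dt_computes_ext S _ _ (fun I => ((da_F I k).1, (da_F I k).2))) => [I|].
  by rewrite -surjective_pairing.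
apply: (dt_computes_bind (psi := fun a I => (a, (da_F I k).2)) (c false)) => a.
exact: dt_computes_map (c true).
Qed.

Lemma dt_computes_hole (uv : vertex * vertex) :
  dt_computes (code_len K) (fun I => da_G I uv).
Proof.
apply: dt_computes_ord => // j; exact: (@dt_computes_query S (inr (uv, j))).
Qed.

Lemma dt_computes_colors (n : nat) (u : 'I_n -> vertex) :
  dt_computes n (fun I => [ffun p => da_C I (u p)]).
Proof.
apply: (@dt_computes_weaken _ _ (n * 1)); first by rewrite muln1.
by apply: dt_computes_ffun => p; exact: dt_computes_color.
Qed.

Lemma dt_computes_compress y :
  dt_computes (m.*2.+1 + m * code_len K) (compress^~ y).
Proof.
pose psi (col : {ffun 'I_(m.*2.+1) -> bool}) I : code :=
  let A := [set p | col p] in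
  ((h A).2, [ffun i => da_G I (paired h A y i)], y (place h A None)).
apply: (dt_computes_bind (psi := psi)) => [|col]; first exact: dt_computes_colors.
apply: (dt_computes_map (fun hs => (_, hs, _))); apply: dt_computes_ffun => i.
exact: dt_computes_hole.
Qed.

(** The colors come last, since the vertices to be inspected are answers of F. *)
Lemma dt_computes_decompress w :
  dt_computes (m * (2 * code_len (2 * N)) + m) (decompress^~ w).
Proof.
pose psi (q : {ffun 'I_m -> vertex * vertex}) I :=
  unpaired h (pattern_of h [set i | [ffun i => da_C I (q i).1] i] w.1.1) q w.2.
apply: (dt_computes_bind (psi := psi)) => [|q].
  by apply: dt_computes_ffun => i; exact: dt_computes_fetch.
apply: (dt_computes_map (fun col : {ffun 'I_m -> bool} =>
  unpaired h (pattern_of h [set i | col i] w.1.1) q w.2)).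
exact: dt_computes_colors.
Qed.

Lemma dt_computes_bad_pair y :
  dt_computes (m.*2.+1 + m * (code_len K + 2 * code_len (2 * N))) (bad_pair^~ y).
Proof.
pose psi (col : {ffun 'I_(m.*2.+1) -> bool}) I :=
  let q := paired h [set p | col p] y in
  oapp q (y ord0, y ord0) [pick i | [ffun i => da_F I (da_G I (q i))] i != q i].
apply: (dt_computes_bind (psi := psi)) => [|col]; first exact: dt_computes_colors.
set q := paired h [set p | col p] y.
apply: (dt_computes_map (fun fg : {ffun 'I_m -> vertex * vertex} =>
  oapp q (y ord0, y ord0) [pick i | fg i != q i])).
apply: dt_computes_ffun => i.
by apply: (dt_computes_bind (psi := fun k I => da_F I k)) => [|k];
  [exact: dt_computes_hole|exact: dt_computes_fetch].
Qed.

(** Here M = N (4 N^2)^m, so 2M = (2N)^(2m+1) counts the words, and the hypothesis says that the E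
    K^m (2N) codes number at most M. *)
Lemma dt_reduction_dual_amgm : 2 * E * K ^ m <= (4 * N ^ 2) ^ m ->
  exists r : dt_reduction S (lossy_code (N * (2 * N) ^ m.*2)),
    red_complexity r <= up_log 2 #|lossy_code_position (N * (2 * N) ^ m.*2)|
      + (m.*2.+1 + m * (code_len K + 2 * code_len (2 * N) + 1)).
Proof.
move=> leE; set d := (X in _ + X).
apply: (@dt_reduction_lossy_code S _ d word code compress decompress bad_pair).
- by rewrite muln_gt0 expn_gt0 N_gt0 muln_gt0 N_gt0.
- by rewrite card_ffun !card_ord expnS mulnA.
- rewrite !card_prod card_ffun !card_ord.
  have -> : N * (2 * N) ^ m.*2 = (4 * N ^ 2) ^ m * N.
   by rewrite -mul2n expnM expnMn mulnC.
  by rewrite mulnA leq_mul2r [_ * 2]mulnC mulnA leE orbT.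
- by move=> y; apply: dt_computes_weaken (dt_computes_compress y); rewrite /d; nia.
- by move=> y; apply: dt_computes_weaken (dt_computes_decompress y); rewrite /d; nia.
- by move=> y; apply: dt_computes_weaken (dt_computes_bad_pair y); rewrite /d; nia.
- exact: decompressP.
Qed.

End Reduction.

(** * Choice of the block length m *)

Section Growth.

Import Order.TTheory GRing.Theory Num.Theory.
Local Open Scope ring_scope.

Lemma expr_bernoulli (R : realType) (x : R) (k : nat) :
  0 <= x -> 1 + k%:R * x <= (1 + x) ^+ k.
Proof.
move=> x_ge0; elim: k => [|k IH]; first by rewrite mul0r addr0 expr0.
rewrite exprS; apply: le_trans (ler_wpM2l _ IH); last by lra.
rewrite -natr1.
have : 0 <= k%:R * (x * x) by rewrite !mulr_ge0.
by nra.
Qed.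

Lemma quadratic_le_expr (R : realType) (b : R) : 1 < b ->
  exists m : nat, 2 * ((m.*2.+2)%:R * (m.*2.+1)%:R) <= b ^+ m.
Proof.
move=> b_gt1; pose x := b - 1; have x_gt0 : 0 < x by rewrite subr_gt0.
(* With b = 1 + x and m = 3k, Bernoulli's inequality gives b^m >= (k x)^3, while 2 (6k+2) (6k+1) <=
   2 * 8k * 7k = 112 k^2. Hence k x^3 >= 112 suffices. *)
pose k := (Num.truncn (112 / x ^+ 3)).+1.
have k_big : 112 / x ^+ 3 < k%:R.
  by rewrite /k -truncn_lt_nat// divr_ge0// exprn_ge0// ltW.
have k_ge1 : 1 <= k%:R :> R by rewrite ler1n.
exists (3 * k)%N.
have -> : b = 1 + x by rewrite /x addrC subrK.
rewrite mulnC exprM.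
have h3 : (k%:R * x) ^+ 3 <= ((1 + x) ^+ k) ^+ 3.
  rewrite lerXn2r ?nnegrE ?mulr_ge0 ?exprn_ge0 ?ltW//; first by lra.
  have := expr_bernoulli k (ltW x_gt0); lra.
apply: le_trans h3; rewrite exprMn.
have h4 : 112 <= k%:R * x ^+ 3.
  by rewrite -ler_pdivrMr ?exprn_gt0// ltW.
have -> : ((k * 3).*2.+2)%:R = 6 * k%:R + 2 :> R by rewrite -natrM -natrD; congr (_%:R); lia.
have -> : ((k * 3).*2.+1)%:R = 6 * k%:R + 1 :> R by rewrite -natrM natr1; congr (_%:R); lia.
move: h4 k_ge1; set u := k%:R; set v := x ^+ 3 => h4 k_ge1.
apply: (@le_trans _ _ (112 * u ^+ 2)); first by nra.
have -> : u ^+ 3 * v = u * v * u ^+ 2 by ring.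
by rewrite ler_wpM2r ?exprn_ge0//; lra.
Qed.

(** As K <= c N^2, the right side is at least (2/c)^m 2^m K^m. The power 2^m pays for the one in
    [pattern_cost], and (2/c)^m, with 2/c > 1, outgrows the quadratic rest. The choice of m is
    independent of N. *)
Lemma block_length_exists (R : realType) (c : R) : 0 < c -> c < 2 ->
  exists m : nat, forall N : nat,
    (2 * pattern_cost m * Num.truncn (c * N%:R ^+ 2) ^ m <= (4 * N ^ 2) ^ m)%N.
Proof.
move=> c_gt0 c_lt2.
have [|m hm] := @quadratic_le_expr R (2 / c); first by rewrite ltr_pdivlMr ?mul1r.
exists m => N; set K := Num.truncn _.
have leK : K%:R <= c * N%:R ^+ 2 :> R by rewrite truncn_le mulr_ge0 ?exprn_ge0 ?(ltW c_gt0).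
rewrite -(ler_nat R) /pattern_cost !(natrM, natrX).
have -> : (4 * N%:R ^+ 2) ^+ m = (2 / c) ^+ m * (2 ^+ m * (c * N%:R ^+ 2) ^+ m) :> R.
  by rewrite -!exprMn; congr (_ ^+ _); field; rewrite gt_eqF.
rewrite [leLHS](_ : _ =
  2 * ((m.*2.+2)%:R * (m.*2.+1)%:R) * (2 ^+ m * K%:R ^+ m)); last by ring.
apply: ler_pM => //; rewrite ?mulr_ge0 ?exprn_ge0//.
rewrite ler_wpM2l ?exprn_ge0// lerXn2r ?nnegrE//.
by apply: le_trans leK.
Qed.

Lemma truncn_le_sqr (R : realType) (c : R) (N : nat) : 0 < c -> c < 2 ->
  (Num.truncn (c * N%:R ^+ 2) <= 2 * N ^ 2)%N.
Proof.
move=> c_gt0 c_lt2; rewrite -(ler_nat R) natrM natrX.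
have h : 0 <= N%:R ^+ 2 :> R by rewrite exprn_ge0.
apply: (@le_trans _ _ (c * N%:R ^+ 2)); first by rewrite truncn_le mulr_ge0 ?(ltW c_gt0).
by rewrite ler_wpM2r// ltW.
Qed.

End Growth.

(** * Logarithmic bounds and the final complexity *)

Lemma up_log_mul_leq (a b : nat) : up_log 2 (a * b) <= up_log 2 a + up_log 2 b.
Proof.
by apply: up_log_min => //; rewrite expnD leq_mul ?up_logP.
Qed.

Lemma up_log_exp_leq (a k : nat) : up_log 2 (a ^ k) <= k * up_log 2 a.
Proof.
elim: k => [|k IH]; first by rewrite expn0 up_log1.
by rewrite expnS mulSn; apply: leq_trans (up_log_mul_leq _ _) _; rewrite leq_add2l.
Qed.

(** With L = [up_log 2 (2 * M)] there are at most 3 M L positions, and 2M and L are both at most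
    2^L. *)
Lemma up_log_card_lossy_code_position (M : nat) : 0 < M ->
  up_log 2 #|lossy_code_position M| <= 2 * up_log 2 (2 * M) + 1.
Proof.
move=> M_gt0; apply: up_log_min => //.
rewrite card_sum !card_prod !card_ord /code_len.
set L := up_log 2 (2 * M).
have leL : up_log 2 M <= L by apply: leq_up_log; lia.
have leM : 2 * M <= 2 ^ L by apply: up_logP.
have ltL : L < 2 ^ L by apply: ltn_expl.
rewrite addn1 expnS [2 * L]mul2n -addnn expnD; move: (2 ^ L) leM ltL => P leM ltL.
nia.
Qed.

Theorem theorem6p4 (R : realType) (c : R) (c_gt0 : (0 < c)%R) (c_lt2 : (c < 2)%R) :
  exists t : nat -> nat,
    polylog t /\ dt_reducible t (dual_amgm_lc c) lossy_code.
Proof.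
have [m hm] := block_length_exists c_gt0 c_lt2.
have [h [h_inj card_h]] := pattern_label m.
pose n := m.*2.+1.
(* Since m depends only on c, this is linear in log N: 2n+1 accounts for the target length and n +
   6m for the depth. The successor covers N = 1, where the logarithm vanishes. *)
exists (fun N => (2 * n + 1 + (n + m * 6)) * (up_log 2 N).+1); split.
  exists (2 * (2 * n + 1 + (n + m * 6))), 1 => N N_gt1.
  by have := up_log_gt0 2 N; rewrite N_gt1 /= expn1; nia.
move=> N N_gt0; set K := Num.truncn (c * N%:R ^+ 2)%R; set L := up_log 2 N.
exists (N * (2 * N) ^ m.*2).
have M_gt0 : 0 < N * (2 * N) ^ m.*2 by rewrite muln_gt0 expn_gt0 N_gt0 muln_gt0 N_gt0.
split=> //.
have pos_le : up_log 2 #|lossy_code_position (N * (2 * N) ^ m.*2)|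
    <= (2 * n + 1) * L.+1.
  apply: leq_trans (up_log_card_lossy_code_position M_gt0) _.
  rewrite mulnA -expnS.
  have := up_log_exp_leq (2 * N) n; rewrite up_logMp// -/L -/n; nia.
(* If c N^2 < 1 there are no holes, hence no map G and no input. *)
have [K0|K_gt0] := posnP K.
  pose v0 : 'I_(2 * N) := Ordinal (ltac:(lia) : 0 < 2 * N).
  have [|r hr] := @dt_reduction_empty (dual_amgm_holes N K) (N * (2 * N) ^ m.*2) (v0, v0).
    by move=> I; case: (da_G I (v0, v0)) => g; rewrite K0.
  by exists r; apply: leq_trans hr _; nia.
have [r hr] := dt_reduction_dual_amgm N_gt0 K_gt0 h_inj card_h (hm N).
exists r; apply: leq_trans hr _.
rewrite -/K mulnDl leq_add// /code_len up_logMp// -/L.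
have leK : up_log 2 K <= 2 * L + 1.
  apply: leq_trans (leq_up_log 2 (truncn_le_sqr N c_gt0 c_lt2)) _.
  rewrite up_logMp ?expn_gt0 ?N_gt0// addn1 ltnS; exact: up_log_exp_leq.
rewrite /n; nia.
Qed.
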